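(* Let $N$, $r$ and $n$ be positive integers. The higher order hypergeometric Bernoulli polynomials $B_{N,n}^{(r)}(x)$ satisfy the recurrence $$B_{N,n+1}^{(r)}(x)=\left(x-\frac{r}{N+1}\right)B_{N,n}^{(r)}(x)-rN\sum_{k=0}^{n-1}\binom{n}{k}\frac{B_{N,n-k+1}}{n-k+1}B_{N,k}^{(r)}(x).$$
   Context: For positive integers $N,r$, the higher order hypergeometric Bernoulli polynomials $B_{N,n}^{(r)}(x)$ ($n\geq 0$) are defined by the generating function $$\left(\frac{t^N/N!}{e^t-T_{N-1}(t)}\right)^r e^{xt}=\sum_{n=0}^\infty B_{N,n}^{(r)}(x)\frac{t^n}{n!},$$ where $T_{N-1}(t)=\sum_{k=0}^{N-1}\frac{t^k}{k!}$ is the Taylor polynomial of order $N-1$ of the exponential function. (The left-hand side is read as a power series in $t$, since $e^t-T_{N-1}(t)=\frac{t^N}{N!}(1+\cdots)$.) The hypergeometric Bernoulli numbers are $B_{N,n}=B_{N,n}^{(1)}(0)$, i.e. $\frac{t^N/N!}{e^t-T_{N-1}(t)}=\sum_{n=0}^\infty B_{N,n}\frac{t^n}{n!}$. *)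

(* Defs.v *)
From HB Require Import structures.
From mathcomp Require Import all_boot all_order all_algebra.
From mathcomp Require Import boolp.

Set Implicit Arguments.
Unset Strict Implicit.
Unset Printing Implicit Defensive.

Import GRing.Theory.
Local Open Scope ring_scope.

(* Formal power series in one indeterminate [fpsX] over a commutative ring.
   [FPS f] is the sum of [f n * fpsX ^+ n]; a series coerces to its sequence
   of coefficients. *)
Record fps (A : Type) := FPS { fps_coef :> nat -> A }.

Lemma fpsP (A : Type) (f g : fps A) : f =1 g <-> f = g.
Proof. by split=> [|-> //]; case: f g => f [g] /= /funext ->. Qed.

HB.instance Definition _ (A : Type) := gen_eqMixin (fps A).
HB.instance Definition _ (A : Type) := gen_choiceMixin (fps A).

Section ComRing.
Variable A : comNzRingType.
Implicit Types (f g h : fps A).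

Definition fps_add f g : fps A := FPS (fun n => f n + g n).
Definition fps_opp f : fps A := FPS (fun n => - f n).
Definition fpsC (a : A) : fps A := FPS (fun n => if n is 0%N then a else 0).
Definition fps_mul f g : fps A :=
  FPS (fun n => \sum_(i < n.+1) f i * g (n - i)%N).

Fact fps_addA : associative fps_add.
Proof. by move=> f g h; apply/fpsP => n /=; rewrite addrA. Qed.
Fact fps_addC : commutative fps_add.
Proof. by move=> f g; apply/fpsP => n /=; rewrite addrC. Qed.
Fact fps_add0 : left_id (fpsC 0) fps_add.
Proof. by move=> f; apply/fpsP => -[|n] /=; rewrite add0r. Qed.
Fact fps_addN : left_inverse (fpsC 0) fps_opp fps_add.
Proof. by move=> f; apply/fpsP => -[|n] /=; rewrite addNr. Qed.

HB.instance Definition _ :=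
  GRing.isZmodule.Build (fps A) fps_addA fps_addC fps_add0 fps_addN.

Let trunc n f : {poly A} := \poly_(i < n.+1) f i.

Let coef_mul n f g m : (m <= n)%N ->
  fps_mul f g m = (trunc n f * trunc n g)`_m.
Proof.
move=> le_mn; rewrite coefM /=; apply: eq_bigr => i _.
have le_im : (i <= m)%N by rewrite -ltnS.
by rewrite !coef_poly !ltnS (leq_trans le_im) // (leq_trans (leq_subr _ _)).
Qed.

Fact fps_mulC : commutative fps_mul.
Proof. by move=> f g; apply/fpsP => n; rewrite !(@coef_mul n) // mulrC. Qed.

Fact fps_mulA : associative fps_mul.
Proof.
move=> f g h; apply/fpsP => n.
transitivity ((trunc n f * (trunc n g * trunc n h))`_n).
  rewrite coefM; apply: eq_bigr => i _.
  by rewrite -coef_mul ?leq_subr // coef_poly ltn_ord.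
rewrite mulrA coefM; apply: eq_bigr => i _.
by rewrite -coef_mul -1?ltnS // coef_poly ltnS leq_subr.
Qed.

Fact fps_mul1 : left_id (fpsC 1) fps_mul.
Proof.
move=> f; apply/fpsP => n /=; rewrite big_ord_recl mul1r subn0 big1 ?addr0 //.
by move=> i _; rewrite mul0r.
Qed.

Fact fps_mulDl : left_distributive fps_mul fps_add.
Proof.
move=> f g h; apply/fpsP => n /=; rewrite -big_split /=.
by apply: eq_bigr => i _; rewrite mulrDl.
Qed.

Fact fps_oner_neq0 : fpsC 1 != 0.
Proof.
apply/eqP => /fpsP /(_ 0%N) /= /eqP.
by rewrite (negPf (oner_neq0 A)).
Qed.

HB.instance Definition _ := GRing.Zmodule_isComNzRing.Build (fps A)
  fps_mulA fps_mulC fps_mul1 fps_mulDl fps_oner_neq0.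

Lemma fps_coef0 n : (0 : fps A) n = 0. Proof. by case: n. Qed.
Lemma fps_coef1 n : (1 : fps A) n = (n == 0%N)%:R. Proof. by case: n. Qed.
Lemma fps_coefC a n : fpsC a n = a *+ (n == 0%N). Proof. by case: n. Qed.
Lemma fps_coefD f g n : (f + g) n = f n + g n. Proof. by []. Qed.
Lemma fps_coefN f n : (- f) n = - f n. Proof. by []. Qed.
Lemma fps_coefB f g n : (f - g) n = f n - g n. Proof. by []. Qed.
Lemma fps_coefM f g n : (f * g) n = \sum_(i < n.+1) f i * g (n - i)%N.
Proof. by []. Qed.
Lemma fps_coefCM a f n : (fpsC a * f) n = a * f n.
Proof.
rewrite fps_coefM big_ord_recl subn0 big1 ?addr0 // => i _.
by rewrite fps_coefC mul0r.
Qed.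
Lemma fps_coef_sum I (s : seq I) (P : pred I) (F : I -> fps A) n :
  (\sum_(i <- s | P i) F i) n = \sum_(i <- s | P i) F i n.
Proof.
by apply: (big_morph (fun f : fps A => f n)) => //; exact: fps_coef0.
Qed.

Lemma fpsC1 : fpsC 1 = 1. Proof. by []. Qed.
Lemma fpsCM a b : fpsC (a * b) = fpsC a * fpsC b.
Proof. by apply/fpsP => n; rewrite fps_coefCM !fps_coefC mulrnAr. Qed.
Lemma fpsC_nat n : fpsC n%:R = n%:R.
Proof.
elim: n => [|n IH]; first by apply/fpsP.
by rewrite !mulrS -IH; apply/fpsP => -[|m] /=; rewrite ?addr0.
Qed.

Definition fpsX : fps A := FPS (fun n => (n == 1%N)%:R).

Lemma fps_coefXM f n : (fpsX * f) n = if n is m.+1 then f m else 0.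
Proof.
rewrite fps_coefM; case: n => [|n]; first by rewrite big_ord1 mul0r.
rewrite big_ord_recl mul0r add0r big_ord_recl mul1r subSS subn0.
by rewrite big1 ?addr0 // => i _; rewrite mul0r.
Qed.

Lemma fps_coefXnM k f n :
  (fpsX ^+ k * f) n = if (k <= n)%N then f (n - k)%N else 0.
Proof.
elim: k n => [|k IH] n; first by rewrite mul1r subn0.
by rewrite exprS -mulrA fps_coefXM; case: n => // n; rewrite IH.
Qed.

Lemma fps_coefXn k n : (fpsX ^+ k) n = (n == k)%:R.
Proof.
rewrite -[_ ^+ k]mulr1 fps_coefXnM fps_coef1 subn_eq0 eqn_leq andbC.
by case: leqP.
Qed.

Lemma fps_coef_exp_small f k n : f 0%N = 0 -> (n < k)%N -> (f ^+ k) n = 0.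
Proof.
move=> f0; elim: k n => // k IH n ltnk; rewrite exprS fps_coefM big1 // => i _.
case: i => -[|i] /= lti; first by rewrite f0 mul0r.
rewrite IH ?mulr0 //; move: ltnk; rewrite ltnS => lenk.
by apply: leq_trans lenk; rewrite ltn_subrL (leq_trans _ (lti : (i < n)%N)).
Qed.

(* [fps_shift k f] is [f / fpsX ^+ k] whenever [f] is divisible by
   [fpsX ^+ k]. *)
Definition fps_shift k f : fps A := FPS (fun n => f (n + k)%N).

Lemma fps_shiftK k f : (forall i, (i < k)%N -> f i = 0) ->
  fpsX ^+ k * fps_shift k f = f.
Proof.
move=> f0; apply/fpsP => n; rewrite fps_coefXnM.
by case: leqP => [lekn /=|/f0 ->//]; rewrite subnK.
Qed.

Lemma fpsXnI k : injective ( *%R (fpsX ^+ k)).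
Proof.
move=> f g /fpsP eq_fg; apply/fpsP => n; have := eq_fg (n + k)%N.
by rewrite !fps_coefXnM leq_addl addnK.
Qed.

End ComRing.

Section UnitRing.
Variable A : comUnitRingType.
Implicit Types (f g : fps A).

Definition fps_unit : {pred fps A} := [pred f : fps A | f 0%N \is a GRing.unit].

(* Geometric series: with [a] the constant term of [f], the inverse is
   [a^-1] times the sum of all powers of [1 - a^-1 f], of which only the
   first [n.+1] contribute to the coefficient of index [n]. *)
Definition fps_geom f n : fps A :=
  \sum_(k < n.+1) (1 - fpsC (f 0%N)^-1 * f) ^+ k.
Definition fps_inv f : fps A :=
  if f \in fps_unit then FPS (fun n => (f 0%N)^-1 * fps_geom f n n) else f.

Fact fps_mulVx : {in fps_unit, left_inverse 1 fps_inv *%R}.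
Proof.
move=> f fU; have f0U : f 0%N \is a GRing.unit by [].
rewrite /fps_inv fU; set u := 1 - fpsC (f 0%N)^-1 * f.
have u0 : u 0%N = 0 by rewrite fps_coefB fps_coefCM mulVr // subrr.
have geomE n m : (m <= n)%N -> fps_geom f n m = fps_geom f m m.
  move=> lemn; rewrite /fps_geom -/u !fps_coef_sum.
  rewrite (@big_ord_widen _ _ _ m.+1 n.+1 (fun k => (u ^+ k) m)) //.
  rewrite [RHS]big_mkcond /=; apply: eq_bigr => k _.
  by case: ltnP => // ltmk; rewrite fps_coef_exp_small.
apply/fpsP => n.
transitivity ((fps_geom f n * (fpsC (f 0%N)^-1 * f)) n).
  rewrite mulrCA fps_coefCM !fps_coefM mulr_sumr; apply: eq_bigr => i _ /=.
  by rewrite geomE -1?ltnS // mulrA.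
have -> : fpsC (f 0%N)^-1 * f = 1 - u by rewrite /u opprB addrC subrK.
rewrite mulrC -[1 - u]opprB mulNr -subrX1 opprB fps_coefB.
by rewrite [X in _ - X]fps_coef_exp_small // subr0.
Qed.

Fact fps_unitPl f g : g * f = 1 -> fps_unit f.
Proof.
move=> /fpsP /(_ 0%N); rewrite fps_coefM big_ord1 /= => gf1.
by apply/unitrPr; exists (g 0%N); rewrite mulrC.
Qed.

Fact fps_inv_out : {in [predC fps_unit], fps_inv =1 id}.
Proof. by move=> f; rewrite inE /= /fps_inv => /negPf ->. Qed.

HB.instance Definition _ := GRing.ComNzRing_hasMulInverse.Build (fps A)
  fps_mulVx fps_unitPl fps_inv_out.

Lemma fps_unitE f : (f \is a GRing.unit) = (f 0%N \is a GRing.unit).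
Proof. by []. Qed.

Lemma fpsC_inv a : a \is a GRing.unit -> fpsC a^-1 = (fpsC a)^-1.
Proof.
move=> aU; have CU : fpsC a \is a GRing.unit by [].
by apply: (mulrI CU); rewrite -fpsCM !divrr.
Qed.

(* The series of e^(a t). *)
Definition fps_exp (a : A) : fps A := FPS (fun n => a ^+ n / n`!%:R).

End UnitRing.

(* [exp_taylor N] is T_{N-1}(t), the sum over k < N; it is 0 for N = 0. *)
Definition exp_taylor (N : nat) : fps {poly rat} :=
  \sum_(k < N) fpsX _ ^+ k / k`!%:R.

(* (t^N / N!) / (e^t - T_{N-1}(t)). The denominator is not invertible as a
   power series, but both terms are divisible by t^N, so the quotient is taken
   after dividing both by t^N; see [hbern_quotP]. *)
Definition hbern_quot (N : nat) : fps {poly rat} :=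
  fps_shift N (fpsX _ ^+ N / N`!%:R)
  / fps_shift N (fps_exp 1 - exp_taylor N).

(* The indeterminate 'X of the coefficients is the variable x. *)
Definition hbern_gf (N r : nat) : fps {poly rat} :=
  hbern_quot N ^+ r * fps_exp 'X.

Definition hbern_poly (N r n : nat) : {poly rat} := n`!%:R * hbern_gf N r n.

Definition hbern_num (N n : nat) : rat := (hbern_poly N 1 n).[0].

Lemma fact_unit n : (n`!%:R : {poly rat}) \is a GRing.unit.
Proof.
rewrite -polyC_natr poly_unitE size_polyC coefC /= unitfE.
by rewrite Num.Theory.pnatr_eq0 -lt0n fact_gt0.
Qed.

Lemma fps_coefXn_fact k n :
  (fpsX {poly rat} ^+ k / k`!%:R) n = (n == k)%:R / k`!%:R.
Proof.
rewrite -fpsC_nat -fpsC_inv ?fact_unit // mulrC fps_coefCM fps_coefXn.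
by rewrite mulrC.
Qed.

Lemma exp_taylorE N n : exp_taylor N n = if (n < N)%N then n`!%:R^-1 else 0.
Proof.
rewrite /exp_taylor fps_coef_sum.
under eq_bigr do rewrite fps_coefXn_fact.
case: ltnP => [ltnN|leNn].
  rewrite (bigD1 (Ordinal ltnN)) //= eqxx mul1r big1 ?addr0 // => i.
  by rewrite -val_eqE /= eq_sym => /negPf ->; rewrite mul0r.
by rewrite big1 // => i _; rewrite gtn_eqF ?mul0r // (leq_trans _ leNn).
Qed.

Lemma exp_taylorBE N n :
  (fps_exp 1 - exp_taylor N) n = if (n < N)%N then 0 else n`!%:R^-1.
Proof.
rewrite fps_coefB exp_taylorE /= expr1n mul1r.
by case: ltnP; rewrite ?subrr ?subr0.
Qed.

Lemma hbern_quotP N (f : fps {poly rat}) :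
  f * (fps_exp 1 - exp_taylor N) = fpsX _ ^+ N / N`!%:R <-> f = hbern_quot N.
Proof.
have denK := @fps_shiftK _ N (fps_exp 1 - exp_taylor N).
have numK := @fps_shiftK _ N (fpsX _ ^+ N / N`!%:R : fps {poly rat}).
rewrite -denK => [|i ltiN]; last by rewrite exp_taylorBE ltiN.
rewrite -[in X in X <-> _]numK => [|i ltiN]; last first.
  by rewrite fps_coefXn_fact ltn_eqF ?mul0r.
have denU : fps_shift N (fps_exp 1 - exp_taylor N) \is a GRing.unit.
  rewrite fps_unitE [fps_shift _ _ _]exp_taylorBE add0n ltnn.
  by rewrite unitrV fact_unit.
rewrite mulrCA /hbern_quot; split=> [/fpsXnI <-|->]; first by rewrite mulrK.
by rewrite divrK.
Qed.

(* Main.v *)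
Require Import Defs.
From mathcomp Require Import all_boot all_order all_algebra.
From mathcomp Require Import ring.

Import GRing.Theory.
Local Open Scope ring_scope.

(** Write [q] for the series [(t^N/N!) / D] with [D = e^t - T_(N-1)], and
    [theta] for [t d/dt]. Since [theta D = t D + N t^N/N! = (t + N q) D],
    applying [theta] to [q D = t^N/N!] and cancelling [D] shows that [q] has
    logarithmic derivative [theta q / q = N - t - N q]. Hence
    [G = q^r e^(xt)] satisfies [theta G = (r (N - t - N q) + x t) G]; the
    coefficients of [t^(n+1)] give the recurrence. *)

Section Euler.
Context {A : comNzRingType}.
Implicit Types f g h : fps A.

(** This is [theta], preferred to [d/dt] because it shifts no index and has [t^N] as an
    eigenvector. *)
Definition fps_euler f : fps A := FPS (fun n => n%:R * f n).

Lemma fps_coef_euler f n : fps_euler f n = n%:R * f n. Proof. by []. Qed.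

Lemma fps_eulerM f g :
  fps_euler (f * g) = fps_euler f * g + f * fps_euler g.
Proof.
apply/fpsP => n; rewrite fps_coefD !fps_coefM /= mulr_sumr -big_split /=.
apply: eq_bigr => i _.
have le_in : (i <= n)%N by rewrite -ltnS.
have -> : n%:R = i%:R + (n - i)%:R :> A by rewrite -natrD subnKC.
ring.
Qed.

Lemma fps_euler1 : fps_euler 1 = 0.
Proof.
by apply/fpsP => n; rewrite fps_coef0; case: n => [|n] /=; rewrite ?mul0r ?mulr0.
Qed.

Lemma fps_euler_exp {f h} r :
  fps_euler f = h * f -> fps_euler (f ^+ r) = r%:R * h * f ^+ r.
Proof.
move=> fE; elim: r => [|r IHr]; first by rewrite expr0 fps_euler1; ring.
by rewrite exprS fps_eulerM IHr fE -natr1; ring.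
Qed.

Lemma fps_coef_natM m f n : (m%:R * f) n = m%:R * f n.
Proof. by rewrite -fpsC_nat fps_coefCM. Qed.

End Euler.

Lemma natr_poly_unit n : (n.+1%:R : {poly rat}) \is a GRing.unit.
Proof.
by rewrite -polyC_natr poly_unitE size_polyC coefC /= unitfE
  Num.Theory.pnatr_eq0.
Qed.

Lemma divr_factS n : n.+1%:R / n.+1`!%:R = n`!%:R^-1 :> {poly rat}.
Proof.
by rewrite factS natrM invrM ?natr_poly_unit ?fact_unit // mulrCA
  divrr ?natr_poly_unit // mulr1.
Qed.

Lemma fps_euler_expX (a : {poly rat}) :
  fps_euler (fps_exp a) = fpsC a * fpsX _ * fps_exp a.
Proof.
apply/fpsP => -[|n]; rewrite -mulrA fps_coefCM fps_coefXM /=.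
  by rewrite mul0r mulr0.
by rewrite mulrCA divr_factS exprS mulrA.
Qed.

(** [D] is not a unit, but it is [t^N] times a series with constant term [1/N!]; both factors
    cancel. *)
Lemma exp_taylorB_mulI N :
  injective (fun f : fps {poly rat} => f * (fps_exp 1 - exp_taylor N)).
Proof.
move=> f g.
rewrite -(@fps_shiftK _ N (fps_exp 1 - exp_taylor N)); last first.
  by move=> i ltiN; rewrite exp_taylorBE ltiN.
rewrite ![_ * (fpsX _ ^+ N * _)]mulrCA => /fpsXnI; apply: mulIr.
by rewrite fps_unitE [fps_shift _ _ _]exp_taylorBE add0n ltnn unitrV fact_unit.
Qed.

(** Since [n/n! = 1/(n-1)!], [theta D] and [t D] agree except at [t^N], where the truncation makes
    the coefficient of [t D] vanish. *)
Lemma fps_euler_exp_taylorB N :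
  fps_euler (fps_exp 1 - exp_taylor N) =
    fpsX _ * (fps_exp 1 - exp_taylor N) + N%:R * (fpsX _ ^+ N / N`!%:R).
Proof.
apply/fpsP => n.
rewrite fps_coefD fps_coef_natM fps_coefXn_fact fps_coefXM.
rewrite fps_coef_euler exp_taylorBE; case: n => [|n].
  by rewrite mul0r; case: N => [|N]; rewrite ?mul0r ?mulr0 ?addr0.
rewrite exp_taylorBE; case: (ltngtP n.+1 N) => [ltnN|ltNn|<-].
- by rewrite mul0r !mulr0 addr0.
- by rewrite mul0r mulr0 addr0 divr_factS.
- by rewrite mul1r add0r.
Qed.

Lemma hbern_quotE N :
  hbern_quot N * (fps_exp 1 - exp_taylor N) = fpsX _ ^+ N / N`!%:R.
Proof. by apply/hbern_quotP. Qed.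

Lemma fps_euler_Xn_fact N :
  fps_euler (fpsX {poly rat} ^+ N / N`!%:R) = N%:R * (fpsX _ ^+ N / N`!%:R).
Proof.
apply/fpsP => n; rewrite fps_coef_natM fps_coef_euler fps_coefXn_fact.
by case: eqP => [->|] //; rewrite mul0r !mulr0.
Qed.

Lemma fps_euler_hbern_quot N :
  fps_euler (hbern_quot N) =
    (N%:R - fpsX _ - N%:R * hbern_quot N) * hbern_quot N.
Proof.
apply: (@exp_taylorB_mulI N) => /=.
have := fps_eulerM (hbern_quot N) (fps_exp 1 - exp_taylor N).
(* The last rewrite turns [t^N/N!] back into [q D], so that every term is a multiple of [D]. *)
rewrite fps_euler_exp_taylorB hbern_quotE fps_euler_Xn_fact -hbern_quotE.
move=> /eqP; rewrite -subr_eq => /eqP <-; ring.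
Qed.

Lemma fps_euler_hbern_gf N r :
  fps_euler (hbern_gf N r) =
    (r%:R * (N%:R - fpsX _ - N%:R * hbern_quot N) + fpsC 'X * fpsX _)
    * hbern_gf N r.
Proof.
rewrite /hbern_gf fps_eulerM fps_euler_expX.
by rewrite (fps_euler_exp r (fps_euler_hbern_quot N)); ring.
Qed.

(* Evaluating the coefficients at [x = 0] preserves the equation that
   characterizes [hbern_quot N]. *)
Lemma hbern_quot_const N n : hbern_quot N n = (hbern_quot N n).[0]%:P.
Proof.
suff /fpsP/(_ n)/esym : FPS (fun m => (hbern_quot N m).[0]%:P) = hbern_quot N.
  by [].
have constV m : (m`!%:R^-1 : {poly rat}) = (m`!%:R^-1).[0]%:P.
  by rewrite -polyC_natr polyCV hornerC.
apply/hbern_quotP/fpsP => m; rewrite fps_coefM fps_coefXn_fact.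
transitivity (((m == N)%:R / N`!%:R : {poly rat}).[0]%:P); last first.
  by case: (m == N); rewrite ?mul1r -?constV // mul0r horner0.
rewrite -fps_coefXn_fact -hbern_quotE fps_coefM horner_sum rmorph_sum.
apply: eq_bigr => i _; rewrite hornerM [RHS]polyCM; congr (_ * _).
rewrite exp_taylorBE; case: ifP => _; last exact: constV.
by rewrite horner0.
Qed.

(** Compare coefficients of [t^N] in [q D = t^N/N!]: [D] has no lower terms, so only [q 0 / N!]
    remains on the left. *)
Lemma hbern_quot0 N : hbern_quot N 0%N = 1.
Proof.
have /fpsP/(_ N) := hbern_quotE N.
rewrite fps_coefM big_ord_recl subn0 exp_taylorBE ltnn fps_coefXn_fact eqxx.
rewrite big1 ?addr0 => [|i _].
  by apply: mulIr; rewrite unitrV fact_unit.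
by rewrite exp_taylorBE /= ltn_subrL (leq_trans _ (ltn_ord i)) // mulr0.
Qed.

(** At [x = 0] only the constant term of [e^(xt)] survives, and the coefficients of [q] are constant
    in [x]. *)
Lemma hbern_numE N n : (hbern_num N n)%:P = n`!%:R * hbern_quot N n.
Proof.
rewrite /hbern_num /hbern_poly /hbern_gf expr1 fps_coefM big_ord_recr /=.
rewrite subnn expr0 fact0 divr1 mulr1 hornerM hornerD horner_sum big1 => [|i _].
  by rewrite add0r -polyC_natr hornerC polyCM -hbern_quot_const.
by rewrite !hornerM hornerXn expr0n subn_eq0 leqNgt ltn_ord mul0r mulr0.
Qed.

(** The recurrence before multiplication by [n!], where the sum is still a plain convolution. *)
Lemma hbern_gf_rec N r n :
  n.+1%:R * hbern_gf N r n.+1 =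
    ('X - (r%:R / N.+1%:R)%:P) * hbern_gf N r n
    - (r * N)%:R *
      \sum_(k < n) hbern_quot N (n.+1 - k)%N * hbern_gf N r k.
Proof.
have := fps_euler_hbern_gf N r.
have := fps_euler_hbern_quot N; have := hbern_quot0 N.
move: (hbern_quot N) (hbern_gf N r) => q g q0 Eq EG.
(* The coefficient of [t] in the equation for [theta q] reads [q1 = N q1 - 1 - 2 N q1]. *)
have coef1 : q 1%N * N.+1%:R = -1.
  have /fpsP/(_ 1%N) := Eq.
  rewrite !mulrBl !fps_coefB -mulrA !fps_coef_natM fps_coefXM fps_coefM.
  rewrite big_ord_recl big_ord1 /= q0 => E.
  apply/eqP; rewrite -subr_eq0; apply/eqP.
  transitivity (1 * q 1%N - (N%:R * q 1%N - 1 - N%:R * (1 * q 1%N + q 1%N * 1))).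
    by rewrite -natr1; ring.
  by rewrite -E subrr.
have {}coef1 : q 1%N = - (N.+1%:R^-1)%:P.
  by apply: (mulIr (natr_poly_unit N)); rewrite coef1 -polyC_natr mulNr -polyCM
    mulVf ?Num.Theory.pnatr_eq0.
have /fpsP/(_ n.+1) := EG.
have -> : (r%:R * (N%:R - fpsX _ - N%:R * q) + fpsC 'X * fpsX _)
    * g =
  (r * N)%:R * g - r%:R * (fpsX _ * g)
  - (r * N)%:R * (g * q)
  + fpsC 'X * (fpsX _ * g) by rewrite natrM; ring.
rewrite fps_coef_euler => ->.
rewrite fps_coefD !fps_coefB fps_coefCM !fps_coef_natM fps_coefXM fps_coefM.
(* Of the two top terms of the convolution, the one with [q 0 = 1] cancels [r N g_(n+1)]. The one
   with [q 1] gives [r N/(N+1)], which combines with [-r] into [-r/(N+1)]. *)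
rewrite !big_ord_recr /= subnn subSnn q0 coef1.
under eq_bigr do rewrite mulrC.
have : N%:R * (N.+1%:R^-1)%:P = 1 - (N.+1%:R^-1)%:P :> {poly rat}.
  rewrite -polyC_natr -polyCM -polyC1 -polyCB; congr (_%:P).
  by rewrite -[N%:R](addrK 1) natr1 mulrBl mul1r mulfV ?Num.Theory.pnatr_eq0.
rewrite polyCM polyC_natr natrM. move: (\sum_(_ < _) _) (_%:P) => S c cE.
ring: cE.
Qed.

Theorem theorem1p8 (N r n : nat) (hN : (0 < N)%N) (hr : (0 < r)%N)
    (hn : (0 < n)%N) :
  hbern_poly N r n.+1 =
    ('X - (r%:R / N.+1%:R)%:P) * hbern_poly N r n
    - (r * N)%:R *:
      \sum_(0 <= k < n)
        ('C(n, k)%:R * (hbern_num N (n - k + 1) / (n - k + 1)%:R))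
          *: hbern_poly N r k.
Proof.
rewrite {1}/hbern_poly factS natrM mulrAC hbern_gf_rec mulrBl; congr (_ - _).
  by rewrite /hbern_poly; ring.
rewrite scaler_nat -[RHS]mulr_natl -mulrA; congr (_ * _).
rewrite big_mkord mulr_suml; apply: eq_bigr => k _.
have le_kn : (k <= n)%N := ltnW (ltn_ord k).
rewrite addn1 -subSn // -mul_polyC !polyCM hbern_numE subSn //.
(* With [m = n-k+1], the factor [m!/m = (n-k)!] from the Bernoulli number completes ['C(n, k) k!] to
   [n!]. *)
rewrite /hbern_poly factS -(bin_fact le_kn) !natrM polyC_natr.
have : (n - k).+1%:R * ((n - k).+1%:R^-1)%:P = 1 :> {poly rat}.
  by rewrite -polyC_natr -polyCM divff ?Num.Theory.pnatr_eq0.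
move: (_^-1)%:P _.+1%:R => c m cE; ring: cE.
Qed.
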